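(* Let $\mathcal{X}$ be an infinite-dimensional complex Banach space and let $\mathcal{S}\subseteq \mathcal{B}(\mathcal{X})$ be an operator band. If there exists a non-zero compact operator in $\overline{\mathcal{A}(\mathcal{S})}$, then $\mathcal{S}$ has a non-trivial hyperinvariant subspace.
   Context: $\mathcal{B}(\mathcal{X})$ is the algebra of all bounded linear operators on $\mathcal{X}$. An operator band is a non-empty multiplicative semigroup $\mathcal{S}\subseteq\mathcal{B}(\mathcal{X})$ of idempotents ($S^2=S$ for each $S\in\mathcal{S}$). $\mathcal{A}(\mathcal{S})$ is the (not necessarily unital) subalgebra of $\mathcal{B}(\mathcal{X})$ generated by $\mathcal{S}$, which is the linear span of $\mathcal{S}$; the bar denotes norm closure. The commutant of $\mathcal{S}$ is $\mathcal{S}'=\{T\in\mathcal{B}(\mathcal{X}) : TS=ST \text{ for all } S\in\mathcal{S}\}$. A subspace means a closed linear subspace of $\mathcal{X}$; it is non-trivial if it is neither $\{0\}$ nor $\mathcal{X}$. A subspace $\mathcal{M}$ is hyperinvariant for $\mathcal{S}$ if $T\mathcal{M}\subseteq\mathcal{M}$ for every $T\in\mathcal{S}\cup\mathcal{S}'$. *)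

(* Defs.v *)
From mathcomp Require Import all_boot all_order all_algebra.
From mathcomp Require Import all_classical all_reals all_analysis.
From mathcomp Require Import complex.
Import Order.TTheory GRing.Theory Num.Theory.
Import numFieldNormedType.Exports.
Set Implicit Arguments.
Unset Strict Implicit.
Unset Printing Implicit Defensive.
Local Open Scope classical_set_scope.
Local Open Scope ring_scope.
Local Open Scope complex_scope.

Section LinearAlgebra.
Variables (K : fieldType) (V : lmodType K).

Definition linear_subspace (M : set V) : Prop :=
  M 0 /\ forall (a : K) (x y : V), M x -> M y -> M (a *: x + y).

Definition infinite_dimensional : Prop :=
  ~ exists (n : nat) (e : 'I_n -> V),
      forall x : V, exists c : 'I_n -> K, x = \sum_(i < n) c i *: e i.

End LinearAlgebra.

Arguments infinite_dimensional {K} V.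

(* Operators are plain functions X -> X, whose pointwise lmodType structure
   is the library's; the product of operators is composition.  Norms in a
   normedModType over R[i] take (real) values in R[i]. *)
Section Operators.
Variables (R : realType) (X : completeNormedModType R[i]).
Implicit Types (T U : X -> X) (S A : set (X -> X)) (M : set X).

Definition bounded_operator T : Prop :=
  linear T /\ exists C : R[i], forall x, `|T x| <= C * `|x|.

(* Meaningful for bounded T only: sup of an unbounded set is 0. *)
Definition operator_norm T : R :=
  sup [set complex.Re `|T x| | x in [set x : X | `|x| <= 1]].

Definition compact_operator T : Prop :=
  bounded_operator T /\ precompact (T @` [set x : X | `|x| <= 1]).

Definition operator_band S : Prop :=
  [/\ S `<=` bounded_operator,
      S !=set0,
      (forall T U, S T -> S U -> S (T \o U))
    & (forall T, S T -> T \o T = T)].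

Definition subalgebra A : Prop :=
  [/\ A `<=` bounded_operator,
      linear_subspace A
    & (forall T U, A T -> A U -> A (T \o U))].

Definition generated_algebra S : set (X -> X) := smallest subalgebra S.

Definition norm_closure A : set (X -> X) :=
  [set T | bounded_operator T /\
     forall eps : R, 0 < eps -> exists2 U, A U & operator_norm (T - U) < eps].

Definition commutant S : set (X -> X) :=
  [set T | bounded_operator T /\ forall U, S U -> T \o U = U \o T].

Definition closed_subspace M : Prop := linear_subspace M /\ closed M.

Definition nontrivial_subspace M : Prop := M <> [set 0] /\ M <> setT.

Definition hyperinvariant S M : Prop :=
  closed_subspace M /\
  forall T, (S `|` commutant S) T -> T @` M `<=` M.

End Operators.

(* Main.v *)
From HB Require Import structures.
Require Import Defs.
From mathcomp Require Import all_boot all_order all_algebra.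
From mathcomp Require Import all_classical all_reals all_analysis.
From mathcomp Require Import complex finmap zify ring.
Import Order.TTheory GRing.Theory Num.Theory.
Import numFieldNormedType.Exports.
Local Open Scope classical_set_scope.
Local Open Scope ring_scope.
Local Open Scope complex_scope.

Set Implicit Arguments.
Unset Strict Implicit.

(** Suppose that the band S, with commutant S', has no non-trivial
    hyperinvariant subspace.

    If S is commutative, the range of each idempotent in S is hyperinvariant,
    so S contains at most 0 and the identity, and the algebra it generates
    consists of scalars.  A non-zero compact K that is a norm limit of scalars
    is close to a scalar c with c large compared to the error, so a finite
    net of the compact image of the unit ball gives, after division by c, a
    finite 1/2-net of the unit ball.  This makes X finite-dimensional
    ([half_net_finite_dimensional]).

    If a and b in S do not commute, two facts collide.

    The first is combinatorial.  In a band, w s w' = w w' as soon as the words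
    w and w' involve the same letters and s involves only letters of w
    ([two_sided_sandwich]).  Hence a difference of two words with equal content
    vanishes between two words of full content, and an induction on the number
    of letters shows that all long products of such differences vanish
    ([diffs_eq0]).  So every finite F in S has a finite chain of linear
    subspaces from {0} to X, all invariant under F and S', along which the
    commutators [x, y] with x, y in F move one step down
    ([lowering_words_vanish]).  Operators with that last property form an ideal
    in which all long enough products vanish.

    The second is a compactness argument in the style of Hilden and Lomonosov.
    Let D be the algebra generated by S and S', or rather the larger algebra
    defined by the lattices of subspaces that its elements preserve
    ([local_hull]).
    By hypothesis all orbits D y with y <> 0 are dense ([orbit_dense]).  Take
    P = [a, b] T0 with T0 in D such that P K x0 <> 0, and a small ball U
    around x0 such that P K stays away from 0 on U.  By density and
    compactness, finitely many T_i in D suffice to bring P y back into U for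
    all y in a neighbourhood of the closure of K U.  An element K' of the
    algebra generated by S, close enough to K, still maps U into that
    neighbourhood, so from x0 one can apply operators T_i P K' for ever without
    leaving U.  But all T_i P K' move one step down the chain of a common finite
    subset of S, so a long enough product of them is 0, whereas 0 is not in U.
    Replacing K by the algebraic element K' before iterating is what makes
    nilpotency available. *)

(** * Linear maps given as functions *)

Section LinearMaps.
Variables (K : fieldType) (V : lmodType K).
Implicit Types T U : V -> V.

Lemma linear_scaleE T : linear T -> forall a x, T (a *: x) = a *: T x.
Proof.
by move=> lT; pose T' := HB.pack T (GRing.isLinear.Build _ _ _ _ T lT)
     : {linear V -> V}; exact: (linearZ_LR T').
Qed.

Lemma linear_subE T : linear T -> forall x y, T (x - y) = T x - T y.
Proof.
by move=> lT; pose T' := HB.pack T (GRing.isLinear.Build _ _ _ _ T lT)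
     : {linear V -> V}; exact: (linearB T').
Qed.

Lemma linear_zeroE T : linear T -> T 0 = 0.
Proof.
by move=> lT; pose T' := HB.pack T (GRing.isLinear.Build _ _ _ _ T lT)
     : {linear V -> V}; exact: (linear0 T').
Qed.

Lemma linear_addE T : linear T -> forall x y, T (x + y) = T x + T y.
Proof. by move=> lT x y; have := lT 1 x y; rewrite !scale1r. Qed.

Lemma linear_comp T U : linear T -> linear U -> linear (T \o U).
Proof. by move=> lT lU a x y; rewrite /= lU lT. Qed.

End LinearMaps.

(** * Words in a band *)

Section BandWords.
Variables (K : fieldType) (V : lmodType K) (I : finType) (e : I -> V -> V).
Hypothesis e_linear : forall i, linear (e i).
Hypothesis e_idem :
  forall w x, foldr e (foldr e x w) w = foldr e x w.

Local Notation act w x := (foldr e x w).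
Local Notation content w := [set i in w]%SET.

Lemma act_linear w : linear (fun x => act w x).
Proof. by elim: w => //= i w IH a x y; rewrite IH e_linear. Qed.

(** If w = w y w = w z w then w = (w z w) (w y w) = w (z w y) w; squaring the
    idempotent z w y and absorbing y and z again leaves w (y z) w. *)
Lemma sandwich_cat (w y z : seq I) :
  (forall x, act (w ++ y ++ w) x = act w x) ->
  (forall x, act (w ++ z ++ w) x = act w x) ->
  forall x, act (w ++ (y ++ z) ++ w) x = act w x.
Proof.
rewrite /= => wyw wzw x.
have {}wyw v : act w (act y (act w v)) = act w v
  by have := wyw v; rewrite !foldr_cat.
have {}wzw v : act w (act z (act w v)) = act w v
  by have := wzw v; rewrite !foldr_cat.
have zwy v : act z (act w (act y (act z (act w (act y v))))) =
    act z (act w (act y v)).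
  by have := e_idem (z ++ w ++ y) v; rewrite !foldr_cat.
have xE : act w x = act w (act z (act w (act y (act w x)))).
  by rewrite wyw wzw.
by rewrite !foldr_cat [RHS]xE -zwy wyw wzw.
Qed.

(** Write w = p i q.  Idempotence of i q gives w = w i q, and then idempotence
    of w i gives w i w = (w i) (w i) q = w i q = w. *)
Lemma sandwich_letter (w : seq I) i : i \in w ->
  forall x, act w (e i (act w x)) = act w x.
Proof.
move=> iw x; pose p := take (index i w) w; pose q := drop (index i w).+1 w.
have wE : w = p ++ [:: i] ++ q.
  by rewrite /p /q /= -{1}(cat_take_drop (index i w) w)
    (drop_nth i) ?index_mem// nth_index.
have wiq v : act w (e i (act q v)) = act w v.
  rewrite {1}wE !foldr_cat /=.
  by have := e_idem ([:: i] ++ q) v; rewrite !foldr_cat /= => ->;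
    rewrite wE !foldr_cat.
rewrite -[X in e i X]wiq.
have := e_idem (w ++ [:: i]) (act q x); rewrite !foldr_cat /= => ->.
by rewrite wiq.
Qed.

(** By the two previous facts the words absorbed by w form a semigroup that
    contains the letters of w. *)
Lemma sandwich (w s : seq I) : {subset s <= w} ->
  forall x, act w (act s (act w x)) = act w x.
Proof.
move=> sw x; rewrite -!foldr_cat -catA; move: x.
elim: s sw => [_ x|i s IH sw]; first by rewrite foldr_cat e_idem.
apply: (sandwich_cat (y := [:: i])); last first.
  by apply: IH => j js; apply: sw; rewrite inE js orbT.
by move=> x; rewrite !foldr_cat /= sandwich_letter// sw// mem_head.
Qed.

(** Since w' = w' w w', the word w s w' equals w (s w') w w', and w absorbs the
    middle factor s w'. *)
Lemma two_sided_sandwich (w w' s : seq I) :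
  {subset s <= w} -> {subset w' <= w} -> {subset w <= w'} ->
  forall x, act w (act s (act w' x)) = act w (act w' x).
Proof.
move=> sw w'w ww' x.
rewrite -[X in act s X](sandwich ww') -(foldr_cat e _ s).
by rewrite sandwich// => i; rewrite mem_cat => /orP[/sw|/w'w].
Qed.

(** Commutators of letters, multiplied on both sides by words, have this form;
    differences of words are easier to multiply. *)
Definition word_diff (t : seq I * seq I) (x : V) : V := act t.1 x - act t.2 x.

Definition balanced (t : seq I * seq I) : bool := content t.1 == content t.2.

Local Notation diffs l x := (foldr word_diff x l).
Local Notation letters l := (flatten [seq t.1 | t <- l]).

Lemma word_diff_linear t : linear (word_diff t).
Proof.
move=> a x y; rewrite /word_diff !act_linear scalerBr opprD.
by rewrite addrACA.
Qed.

Lemma diffs_linear l : linear (fun x => diffs l x).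
Proof. by elim: l => //= t l IH a x y; rewrite IH word_diff_linear. Qed.

Lemma content_cat (v w : seq I) : content (v ++ w) = (content v :|: content w)%SET.
Proof. by apply/setP => i; rewrite !inE mem_cat. Qed.

(** A product of balanced differences expands into signed words, all with the
    same content; so two linear maps that agree on the words with this
    content agree on the product. *)
Lemma eq_on_diffs (P Q : V -> V) : linear P -> linear Q ->
  forall l (r : seq I) x, all balanced l ->
  (forall w, content w = content (r ++ letters l) -> P (act w x) = Q (act w x)) ->
  P (act r (diffs l x)) = Q (act r (diffs l x)).
Proof.
move=> lP lQ l r x; elim: l r => [r _|[p q] l IH r] /=;
  first by apply; rewrite cats0.
move=> /andP[/eqP/= pq bl] PQ; rewrite {1 4}/word_diff/=.
rewrite !(linear_subE (act_linear r)) -!foldr_cat.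
rewrite (linear_subE lP) (linear_subE lQ).
by congr (_ - _); apply: IH => // w wE; apply: PQ;
  rewrite wE !content_cat ?finset.setUA// pq.
Qed.

(** The bound m(k) on the number of factors with k letters satisfies
    m(k + 1) = 2 m(k) + 1.  Split a product of that length into two blocks of
    length m(k) around a middle difference p - q.  A block with fewer letters
    vanishes by induction; otherwise both blocks expand into words with all the
    letters, and w p w' = w w' = w q w' for such words. *)
Lemma diffs_eq0 k l : all balanced l ->
  (#|content (letters l)| <= k)%N -> (2 ^ k.+1 <= (size l).+1)%N ->
  forall x, diffs l x = 0.
Proof.
elim: k l => [|k IH] l bl cl sl x.
  case: l bl cl sl => [//|[p q] l] /= /andP[/eqP/= pq _] + _.
  rewrite leqn0 cards_eq0 content_cat finset.setU_eq0 pq => /andP[/eqP qE _].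
  have nilE (w : seq I) : content w = finset.set0 -> w = [::].
    by case: w => // i w /setP/(_ i); rewrite !inE eqxx.
  by rewrite /word_diff /= (nilE q qE) (nilE p (etrans pq qE)) subrr.
have szl : (2 ^ k.+1 - 1 < size l)%N.
  by move: sl; rewrite [(2 ^ k.+2)%N]expnS; have := expn_gt0 2 k.+1; lia.
(* The middle factor sits at position n = m(k). *)
pose t0 : seq I * seq I := ([::], [::]).
set n := (2 ^ k.+1 - 1)%N in szl.
have lE : l = take n l ++ nth t0 l n :: drop n.+1 l.
  by rewrite -drop_nth// cat_take_drop.
have s1 : (2 ^ k.+1 <= (size (take n l)).+1)%N.
  by rewrite size_takel ?(ltnW szl)// /n; lia.
have s2 : (2 ^ k.+1 <= (size (drop n.+1 l)).+1)%N.
  by rewrite size_drop; move: sl; rewrite [(2 ^ k.+2)%N]expnS /n; lia.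
move: (take n l) (nth t0 l n) (drop n.+1 l) s1 s2 lE => l1 [p q] l2 s1 s2 lE.
rewrite {}lE {sl szl n} in bl cl *.
move: bl cl; rewrite all_cat /= => /and3P[b1 pq b2].
rewrite map_cat flatten_cat /= !content_cat => cl.
have [c1|c1] := leqP #|content (letters l1)| k.
  by rewrite foldr_cat IH.
have [c2|c2] := leqP #|content (letters l2)| k.
  rewrite foldr_cat /= (IH l2)// (linear_zeroE (word_diff_linear _)).
  exact: (linear_zeroE (diffs_linear _)).
set C := (_ :|: _)%SET in cl.
have l1C : content (letters l1) = C.
  by apply/eqP; rewrite eqEcard finset.subsetUl (leq_trans cl).
have l2C : content (letters l2) = C.
  by apply/eqP; rewrite eqEcard /C !finset.setUA finset.subsetUr
    -!finset.setUA (leq_trans cl).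
have pC : {subset p <= C} by move=> i ip; rewrite /C !inE ip orbT.
have qC : {subset q <= C}.
  by move=> i iq; apply: pC; have /eqP/setP/(_ i) := pq; rewrite !inE iq.
have memC (w : seq I) : content w = C -> w =i C.
  by move=> wC i; rewrite -wC inE.
rewrite foldr_cat /=.
rewrite -[LHS]/(id (act [::] (diffs l1 _))).
rewrite (eq_on_diffs (P := id) (Q := fun=> 0)) // => [a u v|w];
  first by rewrite scaler0 addr0.
rewrite cat0s l1C => /memC wC; rewrite /word_diff/=.
rewrite (linear_subE (act_linear w)); apply/eqP; rewrite subr_eq0; apply/eqP.
rewrite -[diffs l2 x]/(act [::] (diffs l2 x)).
apply: (eq_on_diffs (P := fun y => act w (act p y))
  (Q := fun y => act w (act q y))) => //.
- exact: linear_comp (act_linear w) (act_linear p).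
- exact: linear_comp (act_linear w) (act_linear q).
rewrite cat0s l2C => w' /memC w'C /=.
by rewrite !two_sided_sandwich// => i; rewrite ?wC ?w'C//; [apply: qC|apply: pC].
Qed.

End BandWords.

(** * The chain of kernels of a finite band *)

Section KernelChain.
Variables (K : fieldType) (V : lmodType K).
Implicit Types (G F C : set (V -> V)) (L M : set V) (T : V -> V).

Definition invariant_subspace G L : Prop :=
  linear_subspace L /\ forall T, G T -> forall x, L x -> L (T x).

(** T moves down at least as far as the commutators of F, whatever pair of
    G-invariant subspaces is used to measure it.  In this form the notion is
    stable under enlarging F and G and under multiplication by maps that
    preserve the G-invariant subspaces. *)
Definition lowering G F T : Prop :=
  forall L M, invariant_subspace G L -> invariant_subspace G M ->
    (forall a b, F a -> F b -> forall x, L x -> M (a (b x) - b (a x))) ->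
  forall x, L x -> M (T x).

Variables (I : finType) (e : I -> V -> V) (C : set (V -> V)).
Hypothesis e_linear : forall i, linear (e i).
Hypothesis e_idem : forall w x, foldr e (foldr e x w) w = foldr e x w.
Hypothesis C_linear : forall T, C T -> linear T.
Hypothesis C_commute : forall T, C T -> forall i x, T (e i x) = e i (T x).

Local Notation diffs l x := (foldr (word_diff e) x l).
Local Notation balanced := (@balanced I).

Definition kernel_step n : set V :=
  [set x | forall l, all balanced l -> size l = n -> diffs l x = 0].

(** Multiplying the last factor of a product of differences by a letter gives
    another such product, and operators in C commute with all of them. *)
Lemma kernel_step_invariant n : invariant_subspace (range e `|` C) (kernel_step n).
Proof.
have diffs_lin l := diffs_linear e_linear l.
split; [split=> [l _ _|a x y Zx Zy l bl sl]|].
- exact: (linear_zeroE (diffs_lin l)).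
- by rewrite diffs_lin Zx// Zy// scaler0 addr0.
move=> T [[i _ <-]|CT] x Zx l bl sl.
- case/lastP: l bl sl => [_ /= n0|l [p q]].
    by have /= -> := Zx [::] isT n0; apply: linear_zeroE.
  rewrite all_rcons size_rcons => /andP[/eqP/= pq bl] sl.
  have := Zx (rcons l (rcons p i, rcons q i)).
  rewrite all_rcons size_rcons sl !foldr_rcons /word_diff /= !foldr_rcons.
  apply=> //; rewrite bl andbT; apply/eqP => /=.
  by rewrite -!cats1 !content_cat pq.
- have actT w y : T (foldr e y w) = foldr e (T y) w.
    by elim: w => //= i w IH; rewrite (C_commute CT) IH.
  have -> : diffs l (T x) = T (diffs l x).
    elim: l {bl sl} => //= t l ->.
    by rewrite /word_diff (linear_subE (C_linear CT)) !actT.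
  by rewrite Zx//; exact/linear_zeroE/C_linear.
Qed.

(** Each lowering operator maps one kernel step into the previous one; all long
    products of balanced differences vanish, so the top step is the whole
    space, and the bottom step is 0.  The product is expressed through the
    successive images of a vector. *)
Lemma lowering_words_vanish : exists m, forall xs : nat -> V,
  (forall j, exists2 T, lowering (range e `|` C) (range e) T & xs j.+1 = T (xs j)) ->
  xs m = 0.
Proof.
exists (2 ^ #|I|.+1)%N => xs xsT.
suff Zxs k : forall j, (k + j)%N = (2 ^ #|I|.+1)%N -> kernel_step j (xs k).
  by have /(_ [::] isT erefl) := Zxs _ 0%N (addn0 _).
elim: k => [j jE l bl sl|k IH j kj].
  by apply: (diffs_eq0 e_linear e_idem (k := #|I|)) => //;
    rewrite ?sl -?jE ?add0n ?leqnSn ?max_card.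
have [T lowT ->] := xsT k.
apply: (lowT (kernel_step j.+1)); last by apply: IH; rewrite -kj addnS.
- exact: kernel_step_invariant.
- exact: kernel_step_invariant.
move=> _ _ [i _ <-] [h _ <-] x Zx l bl sl.
have := Zx (rcons l ([:: i; h], [:: h; i])).
rewrite all_rcons size_rcons sl foldr_rcons; apply=> //.
by rewrite bl andbT; apply/eqP/setP => z; rewrite !inE orbC.
Qed.

End KernelChain.

(** * Bounded operators and norms with values in the complex numbers *)

Section BoundedOperators.
Variables (R : realType) (X : completeNormedModType R[i]).
Implicit Types (T U : X -> X) (L : set X).

Lemma complex_gt0 (r : R[i]) : 0 < r -> 0 < complex.Re r /\ r = (complex.Re r)%:C.
Proof.
by case: r => a b; rewrite ltcE /= => /andP[/eqP-> a0]; split.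
Qed.

Lemma norm_complexE (x : X) : `|x| = (complex.Re `|x|)%:C.
Proof.
have := normr_ge0 x; case: (`|x|) => a b.
by rewrite lecE /= => /andP[/eqP-> _].
Qed.

Lemma bounded_pos T : bounded_operator T ->
  exists2 C : R[i], 0 < C & forall x, `|T x| <= C * `|x|.
Proof.
move=> [_ [C TC]]; exists (`|C| + 1) => [|x]; first by rewrite ltr_wpDl.
have Cx : 0 <= C * `|x| := le_trans (normr_ge0 _) (TC x).
rewrite (le_trans (TC x))// mulrDl mul1r -(ger0_norm Cx) normrM normr_id.
by rewrite lerDl.
Qed.

Lemma bounded_linear T : bounded_operator T -> linear T.
Proof. by case. Qed.

Lemma bounded_id : bounded_operator (@id X).
Proof. by split=> //; exists 1 => x; rewrite mul1r. Qed.

Lemma bounded_comp T U :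
  bounded_operator T -> bounded_operator U -> bounded_operator (T \o U).
Proof.
move=> bT bU; split.
  by apply: linear_comp; apply: bounded_linear.
have [C C0 TC] := bounded_pos bT; have [D D0 UD] := bounded_pos bU.
exists (C * D) => x /=; rewrite (le_trans (TC _))// -mulrA.
by rewrite ler_wpM2l// ltW.
Qed.

Lemma bounded_lincomb a T U :
  bounded_operator T -> bounded_operator U -> bounded_operator (a *: T + U).
Proof.
move=> bT bU; split.
  move=> c x y; rewrite !fctE (bounded_linear bT) (bounded_linear bU).
  by rewrite !scalerDr !scalerA mulrC addrACA.
have [C C0 TC] := bounded_pos bT; have [D D0 UD] := bounded_pos bU.
exists (`|a| * C + D) => x; rewrite !fctE (le_trans (ler_normD _ _))//.
by rewrite mulrDl lerD// normrZ -mulrA ler_wpM2l.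
Qed.

Lemma bounded_sub T U :
  bounded_operator T -> bounded_operator U -> bounded_operator (T - U).
Proof.
by move=> bT bU; rewrite addrC -scaleN1r; exact: bounded_lincomb.
Qed.

Lemma bounded_continuous T : bounded_operator T -> continuous T.
Proof.
move=> bT; have [C C0 TC] := bounded_pos bT; have lT := bounded_linear bT.
move=> x; apply/cvgrPdist_lt => eps eps0; near=> z.
rewrite -(linear_subE lT) (le_lt_trans (TC _))// -ltr_pdivlMl//.
by near: z; apply: cvgr_dist_lt => //; rewrite mulrC divr_gt0.
Unshelve. all: by end_near. Qed.

Lemma le_operator_norm T (eps : R) : bounded_operator T ->
  operator_norm T < eps -> forall x, `|T x| <= eps%:C * `|x|.
Proof.
move=> bT Teps x; have lT := bounded_linear bT.
have [->|x0] := eqVneq x 0; first by rewrite (linear_zeroE lT) !normr0 mulr0.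
have nx0 : 0 < `|x| by rewrite normr_gt0.
set u := `|x|^-1 *: x.
have nu : `|u| = 1 by rewrite normrZ normfV normr_id mulVf// gt_eqF.
suff Tu : `|T u| <= eps%:C.
  have xE : x = `|x| *: u by rewrite scalerA mulfV ?scale1r// gt_eqF.
  by rewrite [in T x]xE (linear_scaleE lT) normrZ normr_id mulrC ler_wpM2r.
have [C C0 TC] := bounded_pos bT.
rewrite norm_complexE lecR (le_trans _ (ltW Teps))//.
apply: ub_le_sup; last by exists u => //=; rewrite nu.
exists (complex.Re C) => _ [z /= z1 <-].
have [_ CE] := complex_gt0 C0.
rewrite -lecR -norm_complexE -CE (le_trans (TC z))//.
by rewrite -[leRHS]mulr1 ler_wpM2l// ltW.
Qed.

Lemma closure_normP (A : set X) (x : X) :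
  closure A x <-> forall eps : R[i], 0 < eps -> exists2 a, A a & `|x - a| < eps.
Proof.
split=> [clA eps eps0|apx B /nbhs_normP[eps /= eps0 epsB]].
  have /clA[a [Aa /= xa]] : nbhs x (ball_ (fun y => `|y|) x eps).
    by apply/nbhs_normP; exists eps.
  by exists a.
by have [a Aa xa] := apx _ eps0; exists a; split=> //; apply: epsB.
Qed.

Lemma closure_linear_subspace L : linear_subspace L -> linear_subspace (closure L).
Proof.
move=> [L0 LD]; split; first exact: subset_closure.
move=> a x y /closure_normP Lx /closure_normP Ly.
apply/closure_normP => eps eps0.
have a0 : 0 < `|a| + 1 by rewrite ltr_wpDl.
have eps2 : 0 < eps / 2 by rewrite divr_gt0.
have [x' Lx' xx'] := Lx _ (divr_gt0 eps2 a0).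
have [y' Ly' yy'] := Ly _ eps2.
exists (a *: x' + y'); first exact: LD.
rewrite opprD addrACA -scalerBr (le_lt_trans (ler_normD _ _))// [ltRHS](splitr eps).
rewrite ler_ltD// normrZ (@le_trans _ _ ((`|a| + 1) * `|x - x'|))//.
  by rewrite ler_wpM2r// lerDl.
by rewrite -ler_pdivlMl// mulrC ltW.
Qed.

Lemma closure_preserved T L : bounded_operator T ->
  (forall x, L x -> L (T x)) -> forall x, closure L x -> closure L (T x).
Proof.
move=> bT TL x /closure_normP Lx; apply/closure_normP => eps eps0.
have [C C0 TC] := bounded_pos bT.
have [y Ly xy] := Lx _ (divr_gt0 eps0 C0); exists (T y); first exact: TL.
rewrite -(linear_subE (bounded_linear bT)) (le_lt_trans (TC _))//.
by rewrite -ltr_pdivlMl// mulrC.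
Qed.

Lemma norm_closure_approx A K : norm_closure A K -> A `<=` @bounded_operator R X ->
  forall eps : R[i], 0 < eps ->
  exists2 U, A U & forall x, `|K x - U x| <= eps * `|x|.
Proof.
move=> [bK apx] bA eps /complex_gt0[eps0 ->].
have [U AU KU] := apx _ eps0; exists U => // x.
exact: (le_operator_norm (bounded_sub bK (bA _ AU)) KU).
Qed.

End BoundedOperators.

(** * Compactness *)

Lemma compact_finite_subcover (I : choiceType) (T : ptopologicalType) (Q : set T)
    (D : set I) (W : I -> set T) :
  compact Q -> (forall i, D i -> open (W i)) -> Q `<=` cover D W ->
  exists E, [/\ finite_set E, E `<=` D & Q `<=` cover E W].
Proof.
rewrite compact_cover => cQ oW QW; have [E ED QE] := cQ _ _ _ oW QW.
exists [set` E]; split=> //.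
by move=> i /= /ED /set_mem.
Qed.

Section Compactness.
Variables (R : realType) (X : completeNormedModType R[i]).

Lemma precompact_finite_net (A : set X) (eps : R[i]) : precompact A -> 0 < eps ->
  exists s : seq X, forall x, A x -> exists2 y, y \in s & `|x - y| < eps.
Proof.
rewrite precompactE compact_cover => cA eps0.
have [||s _ sA] := cA X setT (fun y => [set x | `|x - y| < eps]).
- move=> y _; rewrite [X in open X](_ : _ = ball y eps); first exact: ball_open.
  by rewrite -ball_normE; apply/seteqP; split=> z /=; rewrite distrC.
- by move=> x _; exists x => //=; rewrite subrr normr0.
- by exists (enum_fset s) => x /subset_closure/sA[y /= ys xy]; exists y.
Qed.

(** A Lebesgue number: Q has positive distance to the complement of W. *)
Lemma compact_uniform_nbhd (Q : set X) (W : set X) :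
  compact Q -> open W -> Q `<=` W ->
  exists2 eps : R[i], 0 < eps & forall y z, Q y -> `|y - z| < eps -> W z.
Proof.
move=> /compact_near_coveringP cQ oW QW.
have [] := cQ _ (0 : R[i]^o)^'+ (fun eps y => forall z, `|y - z| < eps -> W z).
  move=> y Qy; have /nbhs_normP[d /= d0 dW] := open_nbhs_nbhs (conj oW (QW _ Qy)).
  have d2 : 0 < d / 2 by rewrite divr_gt0.
  exists ([set y' | `|y - y'| < d / 2], [set eps | eps < d / 2]) => /=.
    by split; [apply/nbhs_normP; exists (d / 2)|exact: nbhs_right_lt].
  move=> [y' eps] /= [yy' epsd] z y'z; apply: dW => /=.
  have -> : y - z = (y - y') + (y' - z) by rewrite addrA subrK.
  rewrite (le_lt_trans (ler_normD _ _))// (splitr d) ltrD//.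
  exact: lt_trans epsd.
move=> d /= d0 dP; have d2 : 0 < d / 2 by rewrite divr_gt0.
exists (d / 2) => // y z Qy yz; apply: (dP (d / 2) _ d2 y) => //=.
by rewrite sub0r normrN gtr0_norm// [ltRHS](splitr d) ltrDl.
Qed.

End Compactness.

(** * Finite nets and finite dimension *)

Section HalfNet.
Variables (R : realType) (X : completeNormedModType R[i]).

Lemma cvg_real_complex (u : nat -> R) (l : R) :
  u n @[n --> \oo] --> l ->
  ((u n)%:C : R[i]^o) @[n --> \oo] --> (l%:C : R[i]^o).
Proof.
move=> ul; apply/cvgrPdist_lt => eps /complex_gt0[eps0 ->].
near=> n; rewrite -rmorphB /= normc_def /= expr0n addr0 sqrtr_sqr ltcR.
by near: n; move/cvgrPdist_lt : ul; exact.
Unshelve. all: by end_near. Qed.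

(** Subtracting |y| e_i from y, where e_i is a point of the net close to y / |y|,
    at least halves the norm.  Iterating expands x as a series of |r_k| e_(i_k)
    with |r_k| <= 2^-k |x|; collecting the terms with the same i gives x as a
    combination of the e_i, whose coefficients are sums of convergent series of
    non-negative reals. *)
Lemma half_net_finite_dimensional (s : seq X) :
  (forall x : X, `|x| <= 1 -> exists2 y, y \in s & `|x - y| <= 2^-1) ->
  ~ infinite_dimensional X.
Proof.
move=> net; apply; pose n := size s; pose e (i : 'I_n) := nth 0 s i.
exists n, e => x.
have dir (y : X) : exists i : 'I_n, `|y - `|y| *: e i| <= 2^-1 * `|y|.
  have [->|y0] := eqVneq y 0.
    have [|z zs _] := net 0; first by rewrite normr0 ler01.
    have ls : (index z s < n)%N by rewrite index_mem.
    by exists (Ordinal ls); rewrite normr0 scale0r subrr normr0 mulr0.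
  have ny0 : 0 < `|y| by rewrite normr_gt0.
  have [|z zs yz] := net (`|y|^-1 *: y).
    by rewrite normrZ normfV normr_id mulVf// gt_eqF.
  have ls : (index z s < n)%N by rewrite index_mem.
  exists (Ordinal ls); rewrite /e /= nth_index//.
  have -> : y - `|y| *: z = `|y| *: (`|y|^-1 *: y - z).
    by rewrite scalerBr scalerA mulfV ?scale1r// gt_eqF.
  by rewrite normrZ normr_id mulrC ler_wpM2r.
have [ix ixP] := choice dir.
(* The remainders r_k of the expansion, and its partial coefficients c i k. *)
pose r k := iter k (fun y => y - `|y| *: e (ix y)) x.
have r_le k : `|r k| <= (2^-1) ^+ k * `|x|.
  elim: k => [|k IH]; first by rewrite expr0 mul1r.
  by rewrite (le_trans (ixP (r k)))// exprS -mulrA ler_wpM2l.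
pose a k := complex.Re `|r k|.
have aE k : `|r k| = (a k)%:C by exact: norm_complexE.
have a_ge0 k : 0 <= a k by rewrite -lecR -aE normr_ge0.
pose b k : R := 2^-1 ^+ k * a 0%N.
have ab k : a k <= b k.
  rewrite -lecR -aE (le_trans (r_le k))// -[ `|x| ]/( `|r 0%N| ) aE.
  by rewrite /b rmorphM rmorphXn /= fmorphV rmorph_nat.
pose c i k : R := \sum_(j < k | ix (r j) == i) a j.
have c_nd i : nondecreasing_seq (c i).
  apply/nondecreasing_seqP => k.
  rewrite /c [leRHS]big_mkcond big_ord_recr /= -big_mkcond /= lerDl.
  by case: ifP.
have c_ub i k : c i k <= 2 * a 0%N.
  apply: (@le_trans _ _ (\sum_(j < k) b j)).
    rewrite /c big_mkcond; apply: ler_sum => j _.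
    by case: ifP => // _; rewrite (le_trans _ (ab j)).
  rewrite -mulr_suml ler_wpM2r//.
  have -> : \sum_(j < k) 2^-1 ^+ j = 2 - 2 * 2^-1 ^+ k :> R.
    elim: k => [|k IH]; first by rewrite big_ord0 expr0 mulr1 subrr.
    by rewrite big_ord_recr /= IH exprS; field.
  by rewrite gerBl mulr_ge0 ?exprn_ge0 ?invr_ge0.
have c_cvg i : c i k @[k --> \oo] --> limn (c i).
  apply: nondecreasing_is_cvgn; first exact: c_nd.
  by exists (2 * a 0%N) => _ [k _ <-].
have xE k : x - r k = \sum_(i < n) (c i k)%:C *: e i.
  elim: k => [|k IH].
    by rewrite subrr big1// => i _; rewrite /c big_ord0 scale0r.
  have -> : x - r k.+1 = (x - r k) + (a k)%:C *: e (ix (r k)).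
    by rewrite /= -aE opprB addrCA addrC.
  rewrite IH [in LHS](_ : (a k)%:C *: e (ix (r k)) =
     \sum_(i < n) (if ix (r k) == i then (a k)%:C *: e i else 0)); last first.
    by rewrite -big_mkcond /= (big_pred1 (ix (r k)))// => i; rewrite eq_sym.
  rewrite -big_split /=; apply: eq_bigr => i _.
  rewrite /c [in RHS]big_mkcond big_ord_recr /= -big_mkcond /=.
  by case: ifP => _; rewrite ?addr0// rmorphD scalerDl.
exists (fun i => (limn (c i))%:C).
have cvgx : x - r k @[k --> \oo] --> x.
  apply/cvgrPdist_lt => eps /complex_gt0[eps0 ->].
  have b0 : b k @[k --> \oo] --> (0 : R).
    rewrite -(mul0r (a 0%N)); apply: cvgMr_tmp; apply: cvg_expr.
    by rewrite ger0_norm ?invr_ge0// invf_lt1// ltr1n.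
  near=> k; rewrite subKr aE ltcR (le_lt_trans (ab k))//.
  rewrite -[b k]ger0_norm ?(le_trans (a_ge0 k))// -normrN -sub0r.
  by near: k; move/cvgrPdist_lt : b0; exact.
apply: (cvg_unique _ cvgx) => //.
rewrite (_ : (fun k => x - r k) = (fun k => \sum_(i < n) (c i k)%:C *: e i));
  last first.
  exact/funext.
apply: cvg_big => [|i _]; first exact: add_continuous.
apply: cvgZr_tmp.
exact: cvg_real_complex.
Unshelve. all: by end_near. Qed.

(** With K x <> 0 and an error below |K x| / (5 |x|), the approximating scalar c
    is at least 4 times the error; dividing a net of the image of the unit ball
    by c then gives a 1/2-net of the unit ball. *)
Lemma compact_near_scalars_finite_dimensional (K : X -> X) :
  compact_operator K -> K <> 0 ->
  (forall eps : R[i], 0 < eps ->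
    exists c : R[i], forall x, `|K x - c *: x| <= eps * `|x|) ->
  ~ infinite_dimensional X.
Proof.
move=> [bK cK] K0 apx.
have [x Kx] : exists x, K x != 0.
  apply: contrapT => nK; apply: K0; apply/funext => x; apply/eqP.
  by apply: contrapT => /negP Kx; apply: nK; exists x.
have x0 : 0 < `|x|.
  rewrite normr_gt0; apply: contra Kx => /eqP ->.
  by rewrite (linear_zeroE (bounded_linear bK)).
pose eps := `|K x| / (5 * `|x|).
have eps0 : 0 < eps by rewrite divr_gt0 ?normr_gt0// mulr_gt0.
have epsx : `|K x| = 5 * eps * `|x|.
  by rewrite /eps; field; rewrite gt_eqF.
have [c Kc] := apx _ eps0.
have c4 : 4 * eps <= `|c|.
  rewrite -(ler_pM2r x0) -normrZ.
  have : `|K x| <= `|c *: x| + `|K x - c *: x|.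
    by rewrite (le_trans _ (ler_normD _ _))// addrC subrK.
  rewrite epsx => h; have := le_trans h (lerD (lexx _) (Kc x)).
  by rewrite -lerBlDr -mulrBl -[X in _ - X]mul1r -mulrBl (_ : 5 - 1 = 4) //; ring.
have c0 : 0 < `|c| by rewrite (lt_le_trans _ c4)// mulr_gt0.
have [s sP] := precompact_finite_net cK eps0.
apply: (half_net_finite_dimensional (s := [seq c^-1 *: y | y <- s])) => z z1.
have [|y ys zy] := sP (K z); first by exists z.
exists (c^-1 *: y); first exact: map_f.
rewrite -(ler_pM2l c0) -normrZ scalerBr scalerA mulfV -?normr_gt0// scale1r.
have -> : c *: z - y = - (K z - c *: z) + (K z - y) by rewrite opprB addrA subrK.
rewrite (le_trans (ler_normD _ _))// normrN.
apply: (@le_trans _ _ (eps + eps)).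
  apply: lerD; last exact: ltW.
  by rewrite (le_trans (Kc z))// -[leRHS]mulr1 ler_wpM2l// ltW.
rewrite ler_pdivlMr// (_ : (eps + eps) * 2 = 4 * eps)//; ring.
Qed.

End HalfNet.

(** * The algebra generated by a band and its commutant *)

Section LocalHull.
Variables (R : realType) (X : completeNormedModType R[i]).
Variable S : set (X -> X).
Hypothesis bandS : operator_band S.
Implicit Types (T U : X -> X) (F G : set (X -> X)) (L M : set X).

Definition preserves_lattice F T : Prop :=
  forall L, invariant_subspace (F `|` commutant S) L -> forall x, L x -> L (T x).

(** An algebra containing S and its commutant S'.  The elements of the algebra
    that they generate have this property, F being the set of the elements of S
    that occur in an expression of T; finiteness of F is what the chain of
    kernels requires. *)
Definition local_hull T : Prop :=
  bounded_operator T /\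
  exists F, [/\ finite_set F, F `<=` S & preserves_lattice F T].

Lemma invariant_sub G G' (L : set X) : G `<=` G' ->
  invariant_subspace G' L -> invariant_subspace G L.
Proof. by move=> GG' [lL G'L]; split=> // T /GG'; exact: G'L. Qed.

Lemma preserves_lattice_sub F F' T :
  F `<=` F' -> preserves_lattice F T -> preserves_lattice F' T.
Proof.
move=> FF' FT L iL; apply: FT; apply: invariant_sub iL.
by apply: setSU.
Qed.

Lemma local_hull_band T : S T -> local_hull T.
Proof.
move=> ST; split; first by case: bandS => bS _ _ _; exact: bS.
exists [set T]; split=> [||L [_ iL]]; first exact: finite_set1.
  by move=> _ ->.
by apply: iL; left.
Qed.

Lemma local_hull_commutant T : commutant S T -> local_hull T.
Proof.
move=> cT; split; first by case: cT.
exists set0; split=> [||L [_ iL]]; first exact: finite_set0.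
  exact: sub0set.
by apply: iL; right.
Qed.

Lemma local_hull_id : local_hull id.
Proof.
by apply: local_hull_commutant; split; [exact: bounded_id|].
Qed.

Lemma local_hull_lincomb a T U :
  local_hull T -> local_hull U -> local_hull (a *: T + U).
Proof.
move=> [bT [F [finF FS FT]]] [bU [F' [finF' F'S F'U]]].
split; first exact: bounded_lincomb.
exists (F `|` F'); split=> [||L iL x Lx]; first by rewrite finite_setU.
  by rewrite subUset.
have [_ LD] := iL.1; apply: LD.
  exact: (preserves_lattice_sub (@subsetUl _ F F') FT).
exact: (preserves_lattice_sub (@subsetUr _ F F') F'U).
Qed.

Lemma local_hull_comp T U : local_hull T -> local_hull U -> local_hull (T \o U).
Proof.
move=> [bT [F [finF FS FT]]] [bU [F' [finF' F'S F'U]]].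
split; first exact: bounded_comp.
exists (F `|` F'); split=> [||L iL x Lx]; first by rewrite finite_setU.
  by rewrite subUset.
apply: (preserves_lattice_sub (@subsetUl _ F F') FT) => //.
exact: (preserves_lattice_sub (@subsetUr _ F F') F'U).
Qed.

Lemma generated_algebra_local_hull : generated_algebra S `<=` local_hull.
Proof.
apply: smallest_sub; last exact: local_hull_band.
split; first by move=> T [].
- split; last exact: local_hull_lincomb.
  have := local_hull_lincomb (-1) local_hull_id local_hull_id.
  by rewrite scaleN1r addNr.
- exact: local_hull_comp.
Qed.

Lemma finite_common_support (Ts : set (X -> X)) :
  finite_set Ts -> Ts `<=` local_hull ->
  exists F, [/\ finite_set F, F `<=` S & forall T, Ts T -> preserves_lattice F T].
Proof.
move=> finTs TsD.
have /choice[supp suppP] : forall T, exists F, Ts T ->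
    [/\ finite_set F, F `<=` S & preserves_lattice F T].
  move=> T; have [/TsD[_ [F FP]]|nT] := pselect (Ts T); first by exists F.
  by exists set0.
exists (\bigcup_(T in Ts) supp T); split.
- by apply: bigcup_finite => // T /suppP[].
- by move=> U [T /suppP[_ sS _]]; exact: sS.
- move=> T TsT; have [_ _ pT] := suppP T TsT.
  by apply: preserves_lattice_sub pT => U sU; exists T.
Qed.

(** The closure of the orbit of y under the local hull is hyperinvariant and
    contains y. *)
Lemma orbit_dense : (forall M, hyperinvariant S M -> ~ nontrivial_subspace M) ->
  forall y z (eps : R[i]), y != 0 -> 0 < eps ->
  exists2 T, local_hull T & `|z - T y| < eps.
Proof.
move=> irr y z eps y0 eps0; pose O := [set T y | T in local_hull].
have linO : linear_subspace O.
  split.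
    exists (-1 *: id + id).
      exact: local_hull_lincomb local_hull_id local_hull_id.
    by rewrite scaleN1r addNr.
  move=> a _ _ [T hT <-] [U hU <-]; exists (a *: T + U) => //.
  exact: local_hull_lincomb.
have hypO : hyperinvariant S (closure O).
  split; first by split; [exact: closure_linear_subspace|exact: closed_closure].
  move=> T hT _ [x Ox <-].
  have {}hT : local_hull T by case: hT => [/local_hull_band|/local_hull_commutant].
  apply: closure_preserved Ox; first by case: hT.
  by move=> _ [U hU <-]; exists (T \o U) => //; exact: local_hull_comp.
suff clO : closure O = setT.
  have /closure_normP/(_ eps eps0) : closure O z by rewrite clO.
  by move=> [_ [T hT <-] zT]; exists T.
apply: contrapT => nT; apply: (irr _ hypO); split=> // cl0.
have : closure O y by apply: subset_closure; exists id => //; exact: local_hull_id.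
by rewrite cl0 => /= y0'; rewrite y0' eqxx in y0.
Qed.

Lemma word_in_band (I : finType) (e : I -> X -> X) :
  (forall i, S (e i)) -> forall w x, foldr e (foldr e x w) w = foldr e x w.
Proof.
case: bandS => _ _ Scomp Sidem Se [|i w] x //.
(* A non-empty word evaluates to an element of S; the empty one to id. *)
have opE (v : seq I) k z :
    foldr e z (k :: v) =
      foldr (fun j T => e j \o T) (e (last k v)) (belast k v) z.
  by elim: v k => //= j v IH k; rewrite -IH.
rewrite !opE; set T := foldr _ _ _.
suff ST : S T by have /(congr1 (fun f => f x)) := Sidem T ST.
rewrite /T; elim: (belast i w) => //= j v IH; exact: Scomp.
Qed.

Lemma finite_lowering_words_vanish F : finite_set F -> F `<=` S ->
  exists m, forall xs : nat -> X,
  (forall j, exists2 T, lowering (F `|` commutant S) F T & xs j.+1 = T (xs j)) ->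
  xs m = 0.
Proof.
move=> /finite_seqP[s ->] FS; pose e (i : 'I_(size s)) := nth id s i.
have Se i : S (e i) by apply: FS => /=; rewrite mem_nth.
have FE : [set` s] = range e.
  apply/seteqP; split=> [T /= Ts|_ [i _ <-]]; last by rewrite /= mem_nth.
  have iT : (index T s < size s)%N by rewrite index_mem.
  by exists (Ordinal iT) => //; rewrite /e /= nth_index.
rewrite FE; apply: lowering_words_vanish.
- by move=> i; case: bandS => bS _ _ _; apply: bounded_linear; exact: bS.
- exact: word_in_band.
- by move=> T [/bounded_linear].
- by move=> T [_ cT] i x; have /(congr1 (fun f => f x)) := cT _ (Se i).
Qed.

End LocalHull.

(** * Commutative bands *)

Section CommutativeCase.
Variables (R : realType) (X : completeNormedModType R[i]).
Variable S : set (X -> X).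
Hypothesis bandS : operator_band S.
Hypothesis irr : forall M, hyperinvariant S M -> ~ nontrivial_subspace M.

(** The range of a, which is the set of its fixed vectors, is invariant under
    everything that commutes with a. *)
Lemma commutative_band_trivial :
  (forall a b, S a -> S b -> a \o b = b \o a) ->
  forall a, S a -> a = 0 \/ a = id.
Proof.
case: bandS => bS _ _ Sidem comm a Sa.
have ba := bS _ Sa; have la := bounded_linear ba.
pose M := [set x | a x = x].
have hM : hyperinvariant S M.
  split; first split.
  - split; first exact: linear_zeroE la.
    by move=> c x y Mx My; rewrite /M /= la Mx My.
  - have -> : M = (a - id) @^-1` [set 0].
      apply/seteqP; split => x; rewrite /M /= !fctE; first by move=> ->; rewrite subrr.
      by move/eqP; rewrite subr_eq0 => /eqP.
    apply: closed_comp; last first.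
      exact: accessible_closed_set1 (hausdorff_accessible (@norm_hausdorff _ X)) _.
    by move=> x _; apply: bounded_continuous; apply: bounded_sub => //; exact: bounded_id.
  - move=> T ST _ [x Mx <-]; rewrite /M /= -[in RHS]Mx.
    have aT : T \o a = a \o T by case: ST => [ST|[_ ->//]]; exact: comm.
    by have /(congr1 (fun f => f x)) := aT.
have aM x : M (a x) by have /(congr1 (fun f => f x)) := Sidem _ Sa.
have [M0|nM0] := pselect (M = [set 0]).
  by left; apply/funext => x; have := aM x; rewrite M0.
have [MT|nMT] := pselect (M = setT).
  by right; apply/funext => x; have : M x by rewrite MT.
by case: (irr hM).
Qed.

Lemma trivial_band_scalars : (forall a, S a -> a = 0 \/ a = id) ->
  generated_algebra S `<=` [set T | exists c : R[i], T = (fun x => c *: x)].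
Proof.
move=> S01; apply: smallest_sub; last first.
  move=> T /S01[->|->]; [exists 0|exists 1]; apply/funext => x.
    by rewrite scale0r.
  by rewrite scale1r.
split.
- move=> _ [c ->]; split.
    by move=> a x y; rewrite scalerDr !scalerA mulrC.
  by exists `|c| => x; rewrite normrZ.
- split; first by exists 0; apply/funext => x; rewrite scale0r.
  move=> a _ _ [c ->] [d ->]; exists (a * c + d); apply/funext => x.
  by rewrite !fctE scalerDl scalerA.
- move=> _ _ [c ->] [d ->]; exists (c * d); apply/funext => x.
  by rewrite /= scalerA.
Qed.

End CommutativeCase.

(** * Non-commutative bands *)

Section NoncommutativeCase.
Variables (R : realType) (X : completeNormedModType R[i]).
Variable S : set (X -> X).
Hypothesis bandS : operator_band S.
Hypothesis irr : forall M, hyperinvariant S M -> ~ nontrivial_subspace M.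

Lemma commutator_lowering (C : set (X -> X)) F a b :
  F a -> F b -> lowering C F (fun x => a (b x) - b (a x)).
Proof. by move=> Fa Fb L M _ _ LM; exact: (LM a b Fa Fb). Qed.

Lemma lowering_compl (F : set (X -> X)) T U :
  preserves_lattice S F T -> lowering (F `|` commutant S) F U ->
  lowering (F `|` commutant S) F (T \o U).
Proof. by move=> pT lU L M iL iM LM x Lx; apply: pT => //; exact: lU Lx. Qed.

Lemma lowering_compr (F : set (X -> X)) T U :
  lowering (F `|` commutant S) F T -> preserves_lattice S F U ->
  lowering (F `|` commutant S) F (T \o U).
Proof. by move=> lT pU L M iL iM LM x Lx; apply: (lT _ _ iL iM LM); exact: pU. Qed.

(** The names follow the sketch at the top: P = [a, b] T0, the ball U has centre
    x0 and radius r, Q is a compact set that contains K U and on which P has no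
    zero, and Ts is the finite set of the operators T_i. *)
Lemma noncommutative_contradiction a b K :
  S a -> S b -> a \o b <> b \o a ->
  norm_closure (generated_algebra S) K -> compact_operator K -> K <> 0 -> False.
Proof.
move=> Sa Sb ab nK [bK cK] K0.
have hull_sub := generated_algebra_local_hull bandS.
have lK := bounded_linear bK.
have bS := let: And4 bS _ _ _ := bandS in bS.
pose c x := a (b x) - b (a x).
have bc : bounded_operator c.
  apply: (@bounded_sub _ _ (a \o b) (b \o a)); apply: bounded_comp; exact: bS.
have [x1 cx1] : exists x, c x != 0.
  apply: contrapT => nc; apply: ab; apply/funext => x; apply/eqP.
  rewrite -subr_eq0; apply: contrapT => /negP cx; apply: nc; by exists x.
have [x0 Kx0] : exists x, K x != 0.
  apply: contrapT => nK0; apply: K0; apply/funext => x; apply/eqP.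
  by apply: contrapT => /negP Kx; apply: nK0; exists x.
have [Cc Cc0 cC] := bounded_pos bc.
have [T0 hT0 T0P] : exists2 T, local_hull S T & c (T (K x0)) != 0.
  have [|T hT Tx] := orbit_dense bandS irr x1 Kx0 (eps := `|c x1| / Cc).
    by rewrite divr_gt0// normr_gt0.
  exists T => //; apply/eqP => cT0; move: Tx; rewrite ltr_pdivlMr// mulrC => Tx.
  have := le_lt_trans (cC _) Tx.
  by rewrite (linear_subE (bounded_linear bc)) cT0 subr0 ltxx.
pose P := c \o T0.
have bP : bounded_operator P by apply: bounded_comp => //; case: hT0.
have lP := bounded_linear bP.
have [CP CP0 PC] := bounded_pos bP.
have [CK CK0 KC] := bounded_pos bK.
have PKx0 : 0 < `|P (K x0)| by rewrite normr_gt0.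
have CK1 : 0 < CP * (CK + 1) by rewrite mulr_gt0// addr_gt0.
(* For u in the closure of the image of the unit ball |u| < CK + 1, so that
   |r P u| <= |P K x0| / 2; hence P (K x0 + r u) <> 0. *)
pose r := `|P (K x0)| / (CP * (CK + 1)) / 2.
have r0 : 0 < r by rewrite divr_gt0// divr_gt0.
have rE : CP * (CK + 1) * r = `|P (K x0)| / 2.
  by rewrite /r; field; rewrite !gt_eqF// addr_gt0.
pose Q := [set K x0 + r *: y | y in closure (K @` [set x | `|x| <= 1])].
have cQ : compact Q.
  apply: continuous_compact; last by rewrite -precompactE.
  apply: continuous_subspaceT => y.
  by apply: cvgD; [exact: cvg_cst|apply: cvgZl_tmp; exact: cvg_id].
have ballQ x : `|x - x0| < r -> Q (K x).
  move=> xr; exists (r^-1 *: (K x - K x0)); last first.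
    by rewrite scalerA mulfV ?gt_eqF// scale1r addrC subrK.
  apply: subset_closure; exists (r^-1 *: (x - x0)) => /=.
    by rewrite normrZ gtr0_norm ?invr_gt0// mulrC ler_pdivrMr// mul1r ltW.
  by rewrite (linear_scaleE lK) (linear_subE lK).
have PQ y : Q y -> P y != 0.
  move=> [z /closure_normP/(_ _ ltr01)[_ [u /= u1 <-] zu] <-].
  have zK : `|z| < CK + 1.
    rewrite -(subrK (K u) z) addrC (le_lt_trans (ler_normD _ _))// ler_ltD//.
    by rewrite (le_trans (KC u))// -[leRHS]mulr1 ler_wpM2l// ltW.
  apply/eqP; rewrite (linear_addE lP) (linear_scaleE lP) => /eqP.
  rewrite addr_eq0 => /eqP/(congr1 Num.norm); rewrite normrN normrZ gtr0_norm// => E.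
  suff : `|P (K x0)| < `|P (K x0)| by rewrite ltxx.
  rewrite {1}E (@le_lt_trans _ _ (r * (CP * (CK + 1))))//.
    rewrite ler_wpM2l ?(ltW r0)// (le_trans (PC z))// ler_wpM2l ?(ltW CP0)//.
    exact: ltW.
  by rewrite mulrC rE ltr_pdivrMr// mulrDr mulr1 ltrDl.
have nball0 : ~ `|0 - x0| < r.
  by move=> /ballQ/PQ; rewrite (linear_zeroE lK) (linear_zeroE lP) eqxx.
pose W T := [set y | `|x0 - T (P y)| < r].
have oW T : local_hull S T -> open (W T).
  move=> [bT _]; rewrite (_ : W T = (T \o P) @^-1` ball x0 r); last first.
    by rewrite -ball_normE.
  apply: open_comp; last exact: ball_open.
  by move=> y _; apply: bounded_continuous; exact: bounded_comp.
have [y Qy|Ts [finTs TsS QW]] := compact_finite_subcover cQ oW.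
  by have [T hT Ty] := orbit_dense bandS irr x0 (PQ _ Qy) r0; exists T.
have oU : open (cover Ts W) by apply: bigcup_open => T /TsS; exact: oW.
have [eps eps0 epsW] := compact_uniform_nbhd cQ oU QW.
have x0r : 0 < `|x0| + r by rewrite ltr_wpDl.
have eta0 : 0 < eps / (`|x0| + r) by rewrite divr_gt0.
have [|K' aK' KK'] := norm_closure_approx nK _ eta0.
  by move=> T /hull_sub[].
(* Points x of U have norm below |x0| + r, so K' x is within eps of K x. *)
have stepP x : exists T, `|x - x0| < r ->
    Ts T /\ `|T (P (K' x)) - x0| < r.
  have [xr|] := pselect (`|x - x0| < r); last by exists id.
  have [|T TsT] := epsW (K x) (K' x) (ballQ _ xr).
    rewrite (le_lt_trans (KK' x))// mulrAC ltr_pdivrMr// ltr_pM2l//.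
    by rewrite -(subrK x0 x) addrC (le_lt_trans (ler_normD _ _))// ltrD2l.
  by rewrite /W /= distrC; exists T.
have [step {}stepP] := choice stepP.
pose xs n := iter n (fun x => step x (P (K' x))) x0.
have xsr n : `|xs n - x0| < r.
  elim: n => [|n IH]; first by rewrite subrr normr0.
  by case: (stepP _ IH).
(* A finite F for all the T_i, T0 and K'; adding a and b makes [a, b] lowering. *)
have [F [finF FS FT]] : exists F, [/\ finite_set F, F `<=` S &
    forall T, (Ts `|` [set T0; K']) T -> preserves_lattice S F T].
  apply: finite_common_support.
  - rewrite finite_setU; split; first exact: finTs.
    exact: finite_set2.
  - by move=> T [/TsS//|[->|->]//]; exact: hull_sub.
pose F' := F `|` [set a; b].
have finF' : finite_set F'.
  by rewrite finite_setU; split; last exact: finite_set2.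
have F'S : F' `<=` S by move=> T [/FS//|[->|->]].
have {}FT T : (Ts `|` [set T0; K']) T -> preserves_lattice S F' T.
  by move=> /FT; apply: preserves_lattice_sub; exact: subsetUl.
have [m mP] := finite_lowering_words_vanish bandS finF' F'S.
apply: nball0; rewrite -(mP xs); first exact: xsr.
move=> j; exists (step (xs j) \o ((c \o T0) \o K')) => //.
apply: lowering_compl.
  by apply: FT; left; case: (stepP _ (xsr j)).
apply: lowering_compr; last by apply: FT; right; right.
apply: lowering_compr; last by apply: FT; right; left.
by apply: commutator_lowering; right; [left|right].
Qed.

End NoncommutativeCase.

(** * Hyperinvariant subspaces *)

Unset Implicit Arguments.
Set Strict Implicit.

Theorem theorem4p3 (R : realType) (X : completeNormedModType R[i])
    (S : set (X -> X)) :
  infinite_dimensional X ->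
  operator_band S ->
  (exists K : X -> X,
     [/\ norm_closure (generated_algebra S) K, compact_operator K & K <> 0]) ->
  exists M : set X, hyperinvariant S M /\ nontrivial_subspace M.
Proof.
move=> infX bandS [K [nK cK K0]]; apply: contrapT => noM.
have irr M : hyperinvariant S M -> ~ nontrivial_subspace M.
  by move=> hM nM; apply: noM; exists M.
have [[a [b [Sa Sb ab]]]|comm] :=
  pselect (exists a b, [/\ S a, S b & a \o b <> b \o a]).
  exact: (noncommutative_contradiction bandS irr Sa Sb ab nK cK K0).
have {comm} comm a b : S a -> S b -> a \o b = b \o a.
  by move=> Sa Sb; apply: contrapT => ab; apply: comm; exists a, b.
have scal := trivial_band_scalars (commutative_band_trivial bandS irr comm).
apply: (compact_near_scalars_finite_dimensional cK K0) infX => eps eps0.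
have [|U aU KU] := norm_closure_approx nK _ eps0.
  by move=> T /(generated_algebra_local_hull bandS)[].
by have [d UE] := scal _ aU; exists d => x; have := KU x; rewrite UE.
Qed.
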